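(* Let $T>0$ and $p\ge 1$, and let $Q_{(\Delta t)}$ be a splitting for $P_{\Delta t}$ of classical order $p$. For every $f\in\mathcal{M}_T^{p+1}$ there is a constant $C_f$, independent of $n\in\mathbb{N}$ and $\Delta t>0$, such that for all $n\in\mathbb{N}$ and $\Delta t>0$ with $n\Delta t\le T$, $$\lVert P_{n\Delta t}f-Q_{(\Delta t)}^nf\rVert_{\psi_{\ell_0,s_0}}\le C_f\,\Delta t^{p}.$$
   Context: Setting. $X$ is a separable Hilbert space with norm $\lVert\cdot\rVert$; $A$ with domain $\operatorname{dom}A$ generates a strongly continuous pseudocontractive semigroup on $X$ (i.e. $\lVert e^{tA}\rVert\le e^{ct}$ for some $c\in\mathbb{R}$) and has compact resolvent. $\operatorname{dom}A^{\ell}$ is a Hilbert space with norm $\lVert x\rVert_{\operatorname{dom}A^{\ell}}:=(\sum_{k=0}^{\ell}\lVert A^kx\rVert^2)^{1/2}$ ($\operatorname{dom}A^0=X$). Let $m\ge 1$; $\alpha,\sigma_1,\dots,\sigma_d\colon X\to X$ are Lipschitz continuous on $X$ and also Lipschitz continuous $\operatorname{dom}A^{\ell}\to\operatorname{dom}A^{\ell}$ for $\ell=1,\dots,m$; the $\sigma_j$ are continuously differentiable with bounded first derivative. $(W^j_t)_{j=1,\dots,d}$ is a $d$-dimensional Brownian motion. $x(t,x_0)$ is the (mild) solution of $\mathrm{d}x(t,x_0)=(Ax(t,x_0)+\alpha(x(t,x_0)))\,\mathrm{d}t+\sum_{j=1}^d\sigma_j(x(t,x_0))\,\mathrm{d}W^j_t$,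 $x(0,x_0)=x_0$, and $P_tf(x_0):=\mathbb{E}[f(x(t,x_0))]$. With $\alpha_0(z):=\alpha(z)-\frac12\sum_{j=1}^dD\sigma_j(z)\sigma_j(z)$, $z^0(t,x_0)$ is the solution of $\frac{\mathrm{d}}{\mathrm{d}t}z^0=Az^0+\alpha_0(z^0)$, and for $j=1,\dots,d$, $z^j(t,x_0)$ solves the Stratonovich equation $\mathrm{d}z^j=\sigma_j(z^j)\circ\mathrm{d}W^j_t$, all started at $x_0$; $P^j_tf(x_0):=\mathbb{E}[f(z^j(t,x_0))]$, $j=0,\dots,d$. Function spaces. For $\ell\ge 0$, $s\ge 2$ let $\psi_{\ell,s}(x):=(1+\lVert x\rVert_{\operatorname{dom}A^{\ell}}^2)^{s/2}$ on $\operatorname{dom}A^{\ell}$. $(\operatorname{dom}A^{\ell})_w$ is $\operatorname{dom}A^{\ell}$ with its weak topology, and $\mathcal{B}^{\psi_{\ell,s}}((\operatorname{dom}A^{\ell})_w)$ is the closure of the bounded weakly continuous functions $\operatorname{dom}A^{\ell}\to\mathbb{R}$ with respect to $\lVert f\rVert_{\psi_{\ell,s}}:=\sup_x\psi_{\ell,s}(x)^{-1}|f(x)|$. Fix $\ell_0\in\{0,\dots,m-1\}$ and $s_0\ge 2$. $(P_t)$ and $(P^j_t)$, $j=0,\dots,d$, are regarded as strongly continuous semigroups on $\mathcal{B}^{\psi_{\ell_0,s_0}}((\operatorname{dom}A^{\ell_0})_w)$ with operator norms bounded by $e^{\omega t}$, $e^{\omega_jt}$ for some real constants (standing assumption). Their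 infinitesimal generators on this space are $\mathcal{G}$ and $\mathcal{G}_j$. For $q\ge 1$, $\mathcal{M}_T^{q}$ is the set of $f\in\mathcal{B}^{\psi_{\ell_0,s_0}}((\operatorname{dom}A^{\ell_0})_w)$ such that $P_tf\in\operatorname{dom}\mathcal{G}^q\cap\bigcap_{j=0}^d\operatorname{dom}\mathcal{G}_j^q$ for $t\in[0,T]$, $\sup_{t\in[0,T],\,j_1,\dots,j_q\in\{0,\dots,d\}}\lVert\mathcal{G}_{j_1}\cdots\mathcal{G}_{j_q}P_tf\rVert_{\psi_{\ell_0,s_0}}<\infty$ (in particular these compositions are defined), and $\mathcal{G}^iP_tf=(\sum_{j=0}^d\mathcal{G}_j)^iP_tf$ for $i=1,\dots,q$, $t\in[0,T]$. A splitting is a family $Q_{(\Delta t)}=\sum_{k=1}^K\lambda_kP^{i_{k,1}}_{\delta_{k,1}\Delta t}\cdots P^{i_{k,l_k}}_{\delta_{k,l_k}\Delta t}$ with fixed $\lambda_k\ge 0$, $\delta_{k,r}\ge 0$, $i_{k,r}\in\{0,\dots,d\}$. It has classical order $p$ if, in formal power series in $h$ with noncommuting indeterminates $G_0,\dots,G_d$, the expansions of $\sum_k\lambda_ke^{\delta_{k,1}hG_{i_{k,1}}}\cdots e^{\delta_{k,l_k}hG_{i_{k,l_k}}}$ and $e^{h(G_0+\dots+G_d)}$ agree up to and including the terms of degree $p$ in $h$. *)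

(* Defs.v *)
From HB Require Import structures.
From mathcomp Require Import all_boot all_order all_algebra.
From mathcomp Require Import all_classical all_reals all_analysis.
From mathcomp Require Import ring.

Set Implicit Arguments.
Unset Strict Implicit.
Unset Printing Implicit Defensive.

Import Order.TTheory GRing.Theory Num.Theory.
Import numFieldNormedType.Exports.
Import numFieldTopology.Exports.

Local Open Scope classical_set_scope.
Local Open Scope ring_scope.

Definition inner_product (R : realType) (V : normedModType R)
    (dot : V -> V -> R) : Prop :=
  [/\ forall x y, dot x y = dot y x,
      forall (a : R) x y z, dot (a *: x + y) z = a * dot x z + dot y z &
      forall x, dot x x = `|x| ^+ 2].

(* completeness is part of the type of [V] *)
Definition hilbert (R : realType) (V : completeNormedModType R) : Prop :=
  exists dot : V -> V -> R, inner_product dot.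

Definition separable (T : topologicalType) : Prop :=
  exists D : set T, countable D /\ dense D.

(* The value of [op] outside [dom] is irrelevant. *)
Record partial_op (V : Type) := PartialOp { dom : set V; op :> V -> V }.

Definition op_id (V : Type) : partial_op V := PartialOp setT id.

Definition op_comp (V : Type) (A B : partial_op V) : partial_op V :=
  PartialOp [set x | dom B x /\ dom A (B x)] (A \o B).

(* [op_prod [:: A1; ..; Aq]] is [A1 o .. o Aq], on its natural domain. *)
Definition op_prod (V : Type) (As : seq (partial_op V)) : partial_op V :=
  foldr (@op_comp V) (op_id V) As.

Definition op_pow (V : Type) (A : partial_op V) (n : nat) : partial_op V :=
  op_prod (nseq n A).

Definition op_sum (V : zmodType) (n : nat) (A : 'I_n -> partial_op V) :
    partial_op V :=
  PartialOp [set x | forall j, dom (A j) x] (fun x => \sum_j A j x).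

(* Only the values at times [t >= 0] matter. *)
Record c0_semigroup (R : realType) (V : normedModType R) := C0Semigroup {
  sg :> R -> V -> V ;
  sg_linear : forall t, 0 <= t -> linear (sg t) ;
  sg_continuous : forall t, 0 <= t -> continuous (sg t) ;
  sg0 : forall x, sg 0 x = x ;
  sgD : forall s t, 0 <= s -> 0 <= t -> forall x, sg (s + t) x = sg s (sg t x) ;
  sg_cvg0 : forall x, sg t x @[t --> 0^'+] --> x }.

Definition exp_bounded (R : realType) (V : normedModType R)
    (S : c0_semigroup V) : Prop :=
  exists c : R, forall t, 0 <= t -> forall x, `|S t x| <= expR (c * t) * `|x|.

Definition generator (R : realType) (V : normedModType R)
    (S : c0_semigroup V) : partial_op V :=
  PartialOp [set x | cvg (h^-1 *: (S h x - x) @[h --> 0^'+])]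
            (fun x => lim (h^-1 *: (S h x - x) @[h --> 0^'+])).

Definition compact_resolvent (R : realType) (V : normedModType R)
    (A : partial_op V) : Prop :=
  exists (lam : R) (Res : V -> V),
    [/\ forall y, dom A (Res y) /\ lam *: Res y - A (Res y) = y,
        forall x, dom A x -> Res (lam *: x - A x) = x &
        compact (closure (Res @` [set y | `|y| <= 1]))].

Section DomPow.
Variables (R : realType) (X : normedModType R).
Implicit Types (S : c0_semigroup X) (l : nat).

Definition dom_pred S l : {pred X} :=
  fun x => `[< dom (op_pow (generator S) l) x >].

Lemma dom_genZD S (a : R) x y :
  dom (generator S) x -> dom (generator S) y ->
  dom (generator S) (a *: x + y) /\
  generator S (a *: x + y) = a *: generator S x + generator S y.
Proof.
rewrite /dom/= => cx cy.
have key : h^-1 *: (S h (a *: x + y) - (a *: x + y)) @[h --> 0^'+] -->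
    a *: generator S x + generator S y.
  apply: (@cvg_trans _ ((a *: (h^-1 *: (S h x - x)) +
                          h^-1 *: (S h y - y)) @[h --> 0^'+])).
    apply: near_eq_cvg; near=> h.
    have h0 : 0 <= h by near: h; apply: nbhs_right_ge.
    rewrite (sg_linear S h0) opprD addrACA -scalerBr [RHS]scalerDr.
    by rewrite !scalerA [a * _]mulrC.
  by apply: cvgD => //; apply: cvgZr.
split; first by apply/cvg_ex; exists (a *: generator S x + generator S y).
by apply: cvg_lim => //; exact: norm_hausdorff.
Unshelve. all: by end_near. Qed.

Lemma dom_powS S l k x : (k <= l)%N ->
  dom (op_pow (generator S) l) x -> dom (op_pow (generator S) k) x.
Proof.
elim: l k x => [|l IH] k x; first by rewrite leqn0 => /eqP ->.
rewrite leq_eqVlt => /predU1P[-> //|]; rewrite ltnS => kl [dl _].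
exact: IH kl dl.
Qed.

Lemma dom_powZD S l (a : R) x y :
  dom (op_pow (generator S) l) x -> dom (op_pow (generator S) l) y ->
  dom (op_pow (generator S) l) (a *: x + y) /\
  op_pow (generator S) l (a *: x + y) =
    a *: op_pow (generator S) l x + op_pow (generator S) l y.
Proof.
elim: l => [//|l IH] [dx gx] [dy gy].
have [dxy e] := IH dx dy; have [gxy eg] := dom_genZD a gx gy.
by split; [split=> //; rewrite -/(op_pow _ _) e | rewrite /= -/(op_pow _ _) e].
Qed.

Lemma gen0 S : dom (generator S) 0 /\ generator S 0 = 0.
Proof.
have key : h^-1 *: (S h 0 - 0) @[h --> 0^'+] --> (0 : X).
  apply: (@cvg_trans _ ((fun=> 0 : X) h @[h --> 0^'+])); last exact: cvg_cst.
  apply: near_eq_cvg; near=> h.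
  have h0 : 0 <= h by near: h; apply: nbhs_right_ge.
  have := sg_linear S h0 (-1) 0 0.
  by rewrite scaler0 addr0 scaleN1r addNr subr0 => ->; rewrite scaler0.
split; first by apply/cvg_ex; exists 0.
by apply: cvg_lim => //; exact: norm_hausdorff.
Unshelve. all: by end_near. Qed.

Lemma dom_pow0 S l : dom (op_pow (generator S) l) 0 /\
  op_pow (generator S) l 0 = 0.
Proof.
elim: l => [//|l [d0 e0]]; have [g0 eg] := gen0 S.
by split; [split=> //; rewrite -/(op_pow _ _) e0 | rewrite /= -/(op_pow _ _) e0].
Qed.

Lemma dom_pred_submod S l : submod_closed (dom_pred S l).
Proof.
split; first by apply/asboolP; case: (dom_pow0 S l).
move=> a x y /asboolP dx /asboolP dy; apply/asboolP.
by case: (dom_powZD a dx dy).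
Qed.

HB.instance Definition _ S l :=
  GRing.isSubmodClosed.Build R X (dom_pred S l) (dom_pred_submod S l).

Record dom_pow S l := DomPow { dom_val :> X ; _ : dom_val \in dom_pred S l }.

HB.instance Definition _ S l := [isSub for @dom_val S l].
HB.instance Definition _ S l := [Choice of dom_pow S l by <:].
HB.instance Definition _ S l := [SubChoice_isSubLmodule of dom_pow S l by <:].

Definition dom_norm S l (x : dom_pow S l) : R :=
  Num.sqrt (\sum_(k < l.+1) `|op_pow (generator S) k (dom_val x)| ^+ 2).

Lemma minkowski2 n (u v : 'I_n -> R) :
  (forall i, 0 <= u i) -> (forall i, 0 <= v i) ->
  Num.sqrt (\sum_i (u i + v i) ^+ 2) <=
  Num.sqrt (\sum_i u i ^+ 2) + Num.sqrt (\sum_i v i ^+ 2).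
Proof.
move=> u0 v0.
pose a := \sum_i u i ^+ 2; pose b := \sum_i v i ^+ 2.
pose c := \sum_i u i * v i.
have ea : a = \sum_i u i ^+ 2 by []; have eb : b = \sum_i v i ^+ 2 by [].
have ec : c = \sum_i u i * v i by [].
rewrite -ea -eb; clearbody a b c.
have a0 : 0 <= a by rewrite ea; apply: sumr_ge0 => i _; exact: sqr_ge0.
have b0 : 0 <= b by rewrite eb; apply: sumr_ge0 => i _; exact: sqr_ge0.
have c0 : 0 <= c by rewrite ec; apply: sumr_ge0 => i _; exact: mulr_ge0.
have cs : c ^+ 2 <= a * b.
  have [b00|bn] := eqVneq b 0.
    have vz i : v i = 0.
      apply/eqP; rewrite -sqrf_eq0; apply/eqP.
      have /psumr_eq0P : \sum_i v i ^+ 2 = 0 by rewrite -eb.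
      by apply => // j _; exact: sqr_ge0.
    rewrite b00 mulr0 ec big1 ?expr0n// => i _; by rewrite vz mulr0.
  have bp : 0 < b by rewrite lt0r bn.
  have : 0 <= \sum_i (b * u i - c * v i) ^+ 2.
    by apply: sumr_ge0 => i _; exact: sqr_ge0.
  have -> : \sum_i (b * u i - c * v i) ^+ 2 = b * (a * b - c ^+ 2).
    transitivity (b ^+ 2 * a - 2 * b * c * c + c ^+ 2 * b).
      rewrite [in RHS]ea [X in _ - _ * X + _]ec [X in _ + _ * X]eb !mulr_sumr -sumrB -big_split/=.
      apply: eq_bigr => i _; ring.
    by ring.
  by rewrite pmulr_rge0// subr_ge0.
have c_le : c <= Num.sqrt a * Num.sqrt b.
  rewrite -sqrtrM// -(ger0_norm c0) -sqrtr_sqr ler_wsqrtr//.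
rewrite -(@ler_pXn2r _ 2)// ?nnegrE ?sqrtr_ge0 ?addr_ge0 ?sqrtr_ge0//.
rewrite sqr_sqrtr; last by apply: sumr_ge0 => i _; exact: sqr_ge0.
rewrite sqrrD !sqr_sqrtr//.
have -> : \sum_i (u i + v i) ^+ 2 = a + c *+ 2 + b.
  rewrite ea eb ec -mulr_natl mulr_sumr -!big_split/=.
  by apply: eq_bigr => i _; rewrite sqrrD -mulr_natl.
by rewrite lerD2r lerD2l lerMn2r.
Qed.

Lemma dom_norm_triangle S l (x y : dom_pow S l) :
  dom_norm (x + y) <= dom_norm x + dom_norm y.
Proof.
apply: le_trans (minkowski2 _ _) => //.
apply: ler_wsqrtr; apply: ler_sum => k _.
rewrite ler_pXn2r// ?nnegrE// ?addr_ge0//.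
have kl : (k <= l)%N by rewrite -ltnS.
have dx : dom (op_pow (generator S) k) (dom_val x).
  by apply: (dom_powS kl); apply/asboolP; exact: (valP x).
have dy : dom (op_pow (generator S) k) (dom_val y).
  by apply: (dom_powS kl); apply/asboolP; exact: (valP y).
have [_] := dom_powZD 1 dx dy; rewrite !scale1r => e.
have -> : dom_val (x + y) = dom_val x + dom_val y by exact: (raddfD val).
by rewrite e ler_normD.
Qed.

Lemma dom_normZ S l (a : R) (x : dom_pow S l) :
  dom_norm (a *: x) = `|a| * dom_norm x.
Proof.
rewrite /dom_norm -sqrtr_sqr -sqrtrM ?sqr_ge0// mulr_sumr; congr Num.sqrt.
apply: eq_bigr => k _.
have kl : (k <= l)%N by rewrite -ltnS.
have dx : dom (op_pow (generator S) k) (dom_val x).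
  by apply: (dom_powS kl); apply/asboolP; exact: (valP x).
have [d0 e0] := dom_pow0 S k.
have [_] := dom_powZD a dx d0; rewrite e0 !addr0 => e.
have -> : dom_val (a *: x) = a *: dom_val x by exact: (linearZZ val).
by rewrite e normrZ exprMn real_normK// num_real.
Qed.

Lemma dom_norm_eq0 S l (x : dom_pow S l) : dom_norm x = 0 -> x = 0.
Proof.
move=> /eqP; rewrite sqrtr_eq0 => h.
apply: val_inj; apply/eqP; rewrite -normr_eq0 -sqrf_eq0 eq_le sqr_ge0 andbT.
apply: le_trans h; rewrite big_ord_recl/= lerDl.
by apply: sumr_ge0 => i _; exact: sqr_ge0.
Qed.

HB.instance Definition _ S l :=
  Lmodule_isNormed.Build R (dom_pow S l)
    (@dom_norm_triangle S l) (@dom_normZ S l) (@dom_norm_eq0 S l).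

End DomPow.

(* The coarsest topology making every continuous linear functional continuous *)
Definition weak (R : realType) (V : normedModType R) : Type :=
  sup_topology (fun phi : {phi : {linear V -> R^o} | continuous phi} =>
    Topological.on (initial_topology (sval phi))).

HB.instance Definition _ (R : realType) (V : normedModType R) :=
  Topological.on (weak V).

Section Weighted.
Variables (R : realType) (V : normedModType R).
Implicit Types (s : R) (f g : V -> R).

Definition psi s (x : V) : R := (1 + `|x| ^+ 2) `^ (s / 2).

Definition wnorm s f : \bar R := ereal_sup [set (`|f x| / psi s x)%:E | x in setT].

Definition bounded_weakly_continuous f : Prop :=
  continuous (f : weak V -> R^o) /\ exists M : R, forall x, `|f x| <= M.

(* The first conjunct follows from the second one when [0 <= s]; it makes
   the closure a normed space for every real [s]. *)
Definition Bpsi_pred s : {pred (V -> R^o)} := fun f =>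
  `[< (wnorm s f < +oo)%E /\
      forall e : R, 0 < e -> exists2 g, bounded_weakly_continuous g &
        (wnorm s (fun x => (f x - g x)%R) <= e%:E)%E >].

Lemma continuousZD (T : topologicalType) (a : R) (f g : T -> R^o) :
  continuous f -> continuous g ->
  continuous (fun x => a * f x + g x : R^o).
Proof.
move=> cf cg x; apply: cvgD; last exact: cg.
by apply: cvgM; [exact: cvg_cst | exact: cf].
Qed.

Lemma psi_gt0 s x : 0 < psi s x.
Proof. by rewrite powR_gt0// ltr_pwDl// sqr_ge0. Qed.

Lemma wnorm_leP s f (c : R) :
  (wnorm s f <= c%:E)%E <-> forall x, `|f x| <= c * psi s x.
Proof.
split=> [h x|h].
  rewrite -ler_pdivrMr ?psi_gt0// -lee_fin; apply: le_trans h.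
  by apply: ereal_sup_ubound; exists x.
apply: ub_ereal_sup => _ [x _ <-].
by rewrite lee_fin ler_pdivrMr ?psi_gt0.
Qed.

Lemma wnorm_ge0 s f : (0 <= wnorm s f)%E.
Proof.
apply: (@le_trans _ _ (`|f 0| / psi s 0)%:E).
  by rewrite lee_fin divr_ge0// ltW// psi_gt0.
by apply: ereal_sup_ubound; exists 0.
Qed.

Lemma wnorm_ltyP s f :
  (wnorm s f < +oo)%E <-> exists c : R, forall x, `|f x| <= c * psi s x.
Proof.
split=> [h|[c hc]]; last first.
  by apply: le_lt_trans (ltry c); apply/wnorm_leP.
exists (fine (wnorm s f)); apply/wnorm_leP.
by rewrite fineK// ge0_fin_numE// wnorm_ge0.
Qed.

Lemma Bpsi_submod s : submod_closed (Bpsi_pred s).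
Proof.
split.
  apply/asboolP; split.
    by apply/wnorm_ltyP; exists 0 => x; rewrite normr0 mul0r.
  move=> e e0; exists (fun=> 0).
    by split; [exact: cst_continuous | exists 0 => x; rewrite normr0].
  by apply/wnorm_leP => x; rewrite subrr normr0 mulr_ge0 ?ltW// psi_gt0.
move=> a f g /asboolP[/wnorm_ltyP[c hc] hf] /asboolP[/wnorm_ltyP[c' hc'] hg].
apply/asboolP; split.
  apply/wnorm_ltyP; exists (`|a| * c + c') => x.
  rewrite (le_trans (ler_normD _ _))// mulrDl lerD//.
  by rewrite normrM -mulrA ler_wpM2l.
move=> e e0; pose d := e / (2 * (`|a| + 1)).
have a1 : 0 < `|a| + 1 by rewrite ltr_wpDl.
have d0 : 0 < d by rewrite divr_gt0// mulr_gt0.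
have e2 : 0 < e / 2 by rewrite divr_gt0.
have [f' [cf' [M hM]] /wnorm_leP nf] := hf _ d0.
have [g' [cg' [M' hM']] /wnorm_leP ng] := hg _ e2.
exists (fun x => a * f' x + g' x).
  split; first exact: (@continuousZD (weak V)).
  exists (`|a| * M + M') => x.
  by rewrite (le_trans (ler_normD _ _))// lerD// normrM ler_wpM2l.
apply/wnorm_leP => x.
have -> : (a *: f + g) x - (a * f' x + g' x) =
    a * (f x - f' x) + (g x - g' x).
  by rewrite mulrBr opprD addrACA.
have -> : e * psi s x = e / 2 * psi s x + e / 2 * psi s x.
  by rewrite -mulrDl -splitr.
rewrite (le_trans (ler_normD _ _))// lerD// normrM.
apply: (@le_trans _ _ ((`|a| + 1) * (d * psi s x))).
  by apply: ler_pM => //; rewrite lerDl.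
rewrite mulrA; apply: ler_wpM2r; first by rewrite ltW// psi_gt0.
have an0 : `|a| + 1 != 0 by rewrite gt_eqF.
by rewrite le_eqVlt /d; apply/orP; left; apply/eqP; field.
Qed.

HB.instance Definition _ s :=
  GRing.isSubmodClosed.Build R (V -> R^o) (Bpsi_pred s) (Bpsi_submod s).

(* the closure of the bounded weakly continuous functions for [wnorm s] *)
Record Bpsi s := BPsi { bfun :> V -> R^o ; _ : bfun \in Bpsi_pred s }.

HB.instance Definition _ s := [isSub for @bfun s].
HB.instance Definition _ s := [Choice of Bpsi s by <:].
HB.instance Definition _ s := [SubChoice_isSubLmodule of Bpsi s by <:].

Definition Bpsi_norm s (f : Bpsi s) : R := fine (wnorm s f).

Lemma Bpsi_norm_leP s (f : Bpsi s) (c : R) :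
  Bpsi_norm f <= c <-> forall x, `|f x| <= c * psi s x.
Proof.
rewrite -wnorm_leP -lee_fin /Bpsi_norm fineK// ge0_fin_numE ?wnorm_ge0//.
by case/asboolP: (valP f).
Qed.

Lemma Bpsi_norm_ge s (f : Bpsi s) x : `|f x| <= Bpsi_norm f * psi s x.
Proof. by move: x; apply/Bpsi_norm_leP. Qed.

Lemma Bpsi_norm_triangle s (f g : Bpsi s) :
  Bpsi_norm (f + g) <= Bpsi_norm f + Bpsi_norm g.
Proof.
apply/Bpsi_norm_leP => x.
have -> : (f + g : Bpsi s) x = f x + g x.
  by have -> : bfun (f + g) = bfun f + bfun g by exact: (raddfD val).
by rewrite (le_trans (ler_normD _ _))// mulrDl lerD// Bpsi_norm_ge.
Qed.

Lemma Bpsi_normZ s (a : R) (f : Bpsi s) :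
  Bpsi_norm (a *: f) = `|a| * Bpsi_norm f.
Proof.
have le b (g : Bpsi s) : Bpsi_norm (b *: g) <= `|b| * Bpsi_norm g.
  apply/Bpsi_norm_leP => x.
  have -> : (b *: g : Bpsi s) x = b * g x.
    by have -> : bfun (b *: g) = b *: bfun g by exact: (linearZZ val).
  by rewrite normrM -mulrA ler_wpM2l// Bpsi_norm_ge.
apply/eqP; rewrite eq_le le/=.
have [->|a0] := eqVneq a 0.
  by rewrite normr0 mul0r fine_ge0// wnorm_ge0.
have := le a^-1 (a *: f).
rewrite scalerA mulVf// scale1r normfV -ler_pdivrMl ?invr_gt0 ?normr_gt0//.
by rewrite invrK.
Qed.

Lemma Bpsi_norm_eq0 s (f : Bpsi s) : Bpsi_norm f = 0 -> f = 0.
Proof.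
move=> f0; apply: val_inj; apply/funext => x /=.
have := Bpsi_norm_ge f x; rewrite f0 mul0r normr_le0 => /eqP ->.
by have /(congr1 (@^~ x)) /= := raddf0 (val : Bpsi s -> _).
Qed.

HB.instance Definition _ s :=
  Lmodule_isNormed.Build R (Bpsi s)
    (@Bpsi_norm_triangle s) (@Bpsi_normZ s) (@Bpsi_norm_eq0 s).

End Weighted.

Arguments Bpsi {R} V s.

(* [a], as a map [dom A^l -> dom A^l], is Lipschitz for the graph norms. *)
Definition lipschitz_dom (R : realType) (X : normedModType R)
    (S : c0_semigroup X) (l : nat) (a : X -> X) : Prop :=
  exists al : dom_pow S l -> dom_pow S l,
    (forall x, dom_val (al x) = a (dom_val x)) /\ lipschitz al.

Definition C1_bounded (R : realType) (X : normedModType R) (g : X -> X) : Prop :=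
  [/\ forall x, differentiable g x,
      forall x (e : R), 0 < e ->
        \forall y \near x, forall v, `|'d g y v - 'd g x v| <= e * `|v| &
      exists c : R, forall x v, `|'d g x v| <= c * `|v|].

Definition stratonovich_drift (R : realType) (X : normedModType R) (n : nat)
    (alpha : X -> X) (sigma : 'I_n -> X -> X) (z : X) : X :=
  alpha z - 2^-1 *: \sum_j 'd (sigma j) z (sigma j z).

Section Stochastic.
Variables (R : realType) (d : measure_display) (Om : measurableType d).
Variable P : probability Om R.
Variable F : R -> set (set Om).
Local Notation leb := (@lebesgue_measure R).

(* times are [t >= 0] *)
Definition filtration : Prop :=
  (forall t, 0 <= t -> sigma_algebra setT (F t) /\ F t `<=` measurable) /\
  (forall s t, 0 <= s -> s <= t -> F s `<=` F t).

(* Borel measurability with respect to the sigma-algebra [G] *)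
Definition measurable_wrt (G : set (set Om)) (T : topologicalType)
    (Y : Om -> T) : Prop :=
  forall U, open U -> G (Y @^-1` U).

Definition adapted (T : topologicalType) (x : R -> Om -> T) : Prop :=
  forall t, 0 <= t -> measurable_wrt (F t) (x t).

Definition jointly_measurable (T : topologicalType) (D : set R)
    (x : R -> Om -> T) : Prop :=
  forall U, open U ->
    measurable [set p : measurableTypeR R * Om | D p.1 /\ U (x p.1 p.2)].

Definition as_continuous (T : topologicalType) (x : R -> Om -> T) : Prop :=
  {ae P, forall w, {within [set t | 0 <= t], continuous (x ^~ w)}}.

(* The last clause says that the vector [W t - W s] is independent of [F s],
   with independent centred Gaussian entries of variance [t - s]. *)
Definition brownian_motion (n : nat) (W : 'I_n -> R -> Om -> R) : Prop :=
  [/\ forall j, adapted (W j : R -> Om -> R^o),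
      forall j, {ae P, forall w, W j 0 w = 0},
      forall j, as_continuous (W j : R -> Om -> R^o) &
      forall s t, 0 <= s -> s < t ->
      forall (A : set Om) (B : 'I_n -> set (measurableTypeR R)),
        F s A -> (forall j, measurable (B j)) ->
        P (A `&` [set w | forall j, B j (W j t w - W j s w)]) =
        (P A * \big[*%E/1%E]_j normal_prob 0 (Num.sqrt (t - s)) (B j))%E].

Section HilbertValued.
Variable X : normedModType R.

(* [v] is the Bochner integral of [g] over [0, t] (for separable [X], Borel
   maps are strongly measurable by Pettis' theorem). *)
Definition is_bochner_integral (t : R) (g : R -> X) (v : X) : Prop :=
  [/\ forall U, open U ->
        measurable ([set s | 0 <= s <= t /\ U (g s)] : set (measurableTypeR R)),
      leb.-integrable `[0, t] (fun s => `|g s|%:E) &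
      forall phi : {linear X -> R^o}, continuous phi ->
        phi v = \int[leb]_(s in `[0, t]) phi (g s)].

(* [sum_i 1_{]lo i, hi i]} coef i], with [coef i] bounded and
   [F (lo i)]-measurable *)
Record elementary_process (t : R) := ElementaryProcess {
  ep_size : nat ;
  ep_lo : 'I_ep_size -> R ;
  ep_hi : 'I_ep_size -> R ;
  ep_coef : 'I_ep_size -> Om -> X ;
  ep_times : forall i, 0 <= ep_lo i /\ ep_lo i <= ep_hi i <= t ;
  ep_adapted : forall i, measurable_wrt (F (ep_lo i)) (ep_coef i) ;
  ep_bounded : forall i, exists M : R, forall w, `|ep_coef i w| <= M }.

Definition ep_val t (e : elementary_process t) (s : R) (w : Om) : X :=
  \sum_i (if ep_lo i < s <= ep_hi i then ep_coef (e := e) i w else 0).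

Definition ep_integral t (e : elementary_process t) (B : R -> Om -> R)
    (w : Om) : X :=
  \sum_i (B (ep_hi i) w - B (ep_lo i) w) *: ep_coef (e := e) i w.

(* [Y] is (a version of) the Ito integral of [H] over [0, t] with respect to
   the Brownian motion [B]: the L^2-limit of the integrals of elementary
   processes approximating [H] in L^2. *)
Definition is_ito_integral (B : R -> Om -> R) (t : R) (H : R -> Om -> X)
    (Y : Om -> X) : Prop :=
  [/\ jointly_measurable `[0, t] H, measurable_wrt measurable Y &
      exists e : nat -> elementary_process t,
        (\int[P]_w \int[leb]_(s in `[0%R, t])
            (`|ep_val (e k) s w - H s w| ^+ 2)%R%:E)%E @[k --> \oo] --> 0%E /\
        (\int[P]_w (`|ep_integral (e k) B w - Y w| ^+ 2)%R%:E)%E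
          @[k --> \oo] --> 0%E].

(* [Y] is the Stratonovich integral of [H] over [0, t]: the limit in
   probability of the trapezoidal sums as the mesh of the partition of [0, t]
   tends to 0. *)
Definition is_stratonovich_integral (B : R -> Om -> R) (t : R)
    (H : R -> Om -> X) (Y : Om -> X) : Prop :=
  [/\ forall s, 0 <= s <= t -> measurable_wrt measurable (H s),
      measurable_wrt measurable Y &
      forall e : R, 0 < e -> exists2 delta : R, 0 < delta &
        forall (N : nat) (tau : nat -> R), tau 0%N = 0 -> tau N = t ->
          (forall i, (i < N)%N -> 0 <= tau i.+1 - tau i <= delta) ->
          (P [set w | (e <= `|\sum_(i < N) (B (tau i.+1) w - B (tau i) w) *:
                 (2^-1 *: (H (tau i) w + H (tau i.+1) w)) - Y w|)%R]
            <= e%:E)%E].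

(* mild solution of [dx = (A x + alpha(x)) dt + sum_j sigma_j(x) dW^j],
   [x 0 = x0], where [A] generates [S] *)
Definition mild_solution (S : c0_semigroup X) (n : nat)
    (W : 'I_n -> R -> Om -> R) (alpha : X -> X) (sigma : 'I_n -> X -> X)
    (x0 : X) (x : R -> Om -> X) : Prop :=
  [/\ adapted x, jointly_measurable [set t | 0 <= t] x, as_continuous x &
      forall t, 0 <= t -> exists (D : Om -> X) (Y : 'I_n -> Om -> X),
        (forall j, is_ito_integral (W j) t
                     (fun s w => S (t - s) (sigma j (x s w))) (Y j)) /\
        {ae P, forall w,
          is_bochner_integral t (fun s => S (t - s) (alpha (x s w))) (D w) /\
          x t w = S t x0 + D w + \sum_j Y j w}].

(* solution of [dz = sigma(z) o dB], [z 0 = x0] *)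
Definition stratonovich_solution (B : R -> Om -> R) (sigma : X -> X)
    (x0 : X) (z : R -> Om -> X) : Prop :=
  [/\ adapted z, as_continuous z &
      forall t, 0 <= t ->
        is_stratonovich_integral B t (fun s w => sigma (z s w))
          (fun w => z t w - x0)].

(* mild solution of [z' = A z + alpha(z)], [z 0 = x0] *)
Definition mild_ode_solution (S : c0_semigroup X) (alpha : X -> X)
    (x0 : X) (z : R -> X) : Prop :=
  {within [set t | 0 <= t], continuous z} /\
  forall t, 0 <= t -> exists2 D : X,
    is_bochner_integral t (fun s => S (t - s) (alpha (z s))) D &
    z t = S t x0 + D.

(* [E f(x(t, x0))] for [f] and [x0] on [dom A^l]; [f] is extended by 0 off
   [dom A^l]; this value is immaterial as soon as the process almost surely
   stays in [dom A^l]. *)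
Definition expect_at (S : c0_semigroup X) (l : nat)
    (x : X -> R -> Om -> X) (t : R) (f : dom_pow S l -> R)
    (x0 : dom_pow S l) : R :=
  fine 'E_P[fun w => oapp f 0 (insub (x (dom_val x0) t w))].

End HilbertValued.
End Stochastic.

(* [:: (lam_1, [:: (delta_11, i_11); ..]); ..] stands for
   [sum_k lam_k P^(i_k1)_(delta_k1 dt) .. P^(i_kl)_(delta_kl dt)]. *)
Definition splitting (R : realType) (n : nat) : Type :=
  seq (R * seq (R * 'I_n)).

Definition nonneg_splitting (R : realType) (n : nat) (Q : splitting R n) : bool :=
  all (fun b => (0 <= b.1) && all (fun c => 0 <= c.1) b.2) Q.

Definition splitting_op (R : realType) (n : nat) (Q : splitting R n)
    (V : normedModType R) (S : 'I_n -> c0_semigroup V) (dt : R) (f : V) : V :=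
  \sum_(b <- Q) b.1 *: foldr (fun c g => S c.2 (c.1 * dt) g) f b.2.

Section FormalSeries.
Variables (R : realType) (n : nat).

(* Formal power series in noncommuting indeterminates [h G_i], [i < n], as
   their coefficients on words. As [h] only occurs through the [h G_i], the
   degree in [h] of a word is its length. *)
Definition fseries : Type := seq 'I_n -> R.

Definition fs_one : fseries := fun w => (w == [::])%:R.

Definition fs_mul (a b : fseries) : fseries := fun w =>
  \sum_(k < (size w).+1) a (take k w) * b (drop k w).

Definition fs_prod (s : seq fseries) : fseries := foldr fs_mul fs_one s.

(* [exp a = sum_k a^k / k!] for [a] without constant term, so that [a^k]
   vanishes on words of length [< k] *)
Definition fs_exp (a : fseries) : fseries := fun w =>
  \sum_(k < (size w).+1) k`!%:R^-1 * fs_prod (nseq k a) w.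

Definition fs_var (i : 'I_n) : fseries := fun w => (w == [:: i])%:R.

Definition splitting_series (Q : splitting R n) : fseries := fun w =>
  \sum_(b <- Q) b.1 *
    fs_prod [seq fs_exp (fun v => c.1 * fs_var c.2 v) | c <- b.2] w.

Definition classical_order (p : nat) (Q : splitting R n) : Prop :=
  forall w : seq 'I_n, (size w <= p)%N ->
    splitting_series Q w = fs_exp (fun v => \sum_i fs_var i v) w.

End FormalSeries.

Definition smooth_class (R : realType) (V : normedModType R) (n : nat)
    (P : c0_semigroup V) (Pj : 'I_n -> c0_semigroup V) (T : R) (q : nat)
    (f : V) : Prop :=
  let G := generator P in
  let Gj j := generator (Pj j) in
  [/\ forall t, 0 <= t <= T ->
        dom (op_pow G q) (P t f) /\ forall j, dom (op_pow (Gj j) q) (P t f),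
      forall t (js : q.-tuple 'I_n), 0 <= t <= T ->
        dom (op_prod (map Gj js)) (P t f),
      exists C : R, forall t (js : q.-tuple 'I_n), 0 <= t <= T ->
        `|op_prod (map Gj js) (P t f)| <= C &
      forall i t, (1 <= i <= q)%N -> 0 <= t <= T ->
        dom (op_pow (op_sum Gj) i) (P t f) /\
        op_pow G i (P t f) = op_pow (op_sum Gj) i (P t f)].

(* Main.v *)
Require Import Defs.
From HB Require Import structures.
From mathcomp Require Import all_boot all_order all_algebra.
From mathcomp Require Import all_classical all_reals all_analysis.
From mathcomp Require Import ring.

Set Implicit Arguments.
Unset Strict Implicit.
Unset Printing Implicit Defensive.

Import Order.TTheory GRing.Theory Num.Theory.
Import numFieldNormedType.Exports.
Import numFieldTopology.Exports.

Local Open Scope classical_set_scope.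
Local Open Scope ring_scope.

(** The statement holds for any nonempty finite family of exponentially bounded
strongly continuous semigroups [S j] on a normed space, and is the classical
argument that stability and consistency give convergence.

Consistency.  Put [x = P t f] and write [G_w x] for the generators of the
[S j] composed along a word [w].  Taylor's formula ([taylor_remainder]),
applied to one factor after the other, expands every product of the
semigroups in powers of [h]; the coefficient of [G_w x] is the coefficient of
[w] in the corresponding product of formal exponentials
([block_op_expansion]), and each remainder only involves words of length
[p + 1], which are bounded uniformly in [t] by membership of [f] in the smooth
class.  The order condition turns the coefficients of the splitting up to
degree [p] into those of [exp (G_0 + ... + G_d)], namely [1 / |w|!].
Summing over all words of a given length gives the powers of the sum of
the generators ([op_pow_sum_words]), which agree with the powers of the
generator of [P] at [x].  The splitting and [P h] thus have the same Taylor
polynomial, and differ by [O(h ^ (p + 1))].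

Stability.  The order condition on the empty word says that the weights sum
to 1.  As they are nonnegative, the splitting is a convex combination of
products of semigroups, hence has norm at most [exp (Om * h)]
([splitting_op_growth]).

Convergence.  The error after [n] steps is the sum of [n] local errors, each
carried forward by a power of the splitting ([iter_error]); since [n * h <= T]
these powers are bounded by [exp (Om * T)], and [n] errors of size
[O(h ^ (p + 1))] add up to [O(T * h ^ p)].

As integrals may fail to exist in an incomplete normed space, Taylor's formula
rests on a mean value inequality, obtained by subdividing the time interval
([norm_increments_le]). *)

(** * Exponential series in noncommuting letters *)

Section FormalExponential.
Variables (R : realType) (n : nat) (c : 'I_n -> R) (a : fseries R n).
Hypothesis a_neq1 : forall w, size w != 1 -> a w = 0.
Hypothesis a_eq1 : forall i, a [:: i] = c i.

Lemma fs_prod_nseq k w :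
  fs_prod (nseq k a) w = (size w == k)%:R * \prod_(i <- w) c i.
Proof.
elim: k w => [|k IH] w /=.
  by rewrite /fs_one size_eq0; case: eqP => [->|_]; rewrite ?big_nil ?mulr1 ?mul0r.
rewrite /fs_mul; case: w => [|i w].
  by rewrite big_ord1 /= a_neq1 // mul0r mul0r.
rewrite (bigD1 (inord 1)) //= inordK //= take0 drop0 a_eq1 -/(fs_prod _) IH.
rewrite [X in _ + X]big1 => [|j jn1]; first by rewrite addr0 big_cons eqSS mulrCA.
rewrite a_neq1 ?mul0r// size_take_min (minn_idPl _) -1?ltnS //.
by apply: contraNneq jn1 => j1; apply/eqP/val_inj; rewrite /= inordK.
Qed.

(** Only the [k = |w|] term of the exponential series sees a word [w], as a
homogeneous linear series to the power [k] is supported on words of length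
[k]. *)
Lemma fs_exp_linear w :
  fs_exp a w = (size w)`!%:R^-1 * \prod_(i <- w) c i.
Proof.
rewrite /fs_exp big_ord_recr /= fs_prod_nseq eqxx mul1r big1 ?add0r// => k _.
by rewrite fs_prod_nseq gtn_eqF ?mul0r ?mulr0.
Qed.

End FormalExponential.

Lemma fs_exp_sum_var (R : realType) n (w : seq 'I_n) :
  fs_exp (fun v => \sum_i fs_var R i v) w = (size w)`!%:R^-1.
Proof.
rewrite (@fs_exp_linear _ _ (fun=> 1)) ?big1 ?mulr1//.
- move=> v sv; rewrite big1 // => i _; rewrite /fs_var.
  by case: (eqVneq v [:: i]) sv => [->|].
- move=> i; rewrite (bigD1 i) //= /fs_var eqxx big1 ?addr0// => j ji.
  by rewrite eqseq_cons andbT eq_sym (negbTE ji).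
Qed.

Section WordSum.
Variable n : nat.

(** The sum of [F] over all words of length [N].  Recursion on the first
letter makes composition of operators along a word, which also adds letters on
the left, commute with the sum by computation. *)
Fixpoint wsum (V : nmodType) N (F : seq 'I_n -> V) : V :=
  if N is N'.+1 then \sum_i wsum N' (fun w => F (i :: w)) else F [::].

Lemma eq_wsum (V : nmodType) N (F F' : seq 'I_n -> V) :
  (forall w, size w = N -> F w = F' w) -> wsum N F = wsum N F'.
Proof.
elim: N F F' => [|N IH] F F' FF' /=; first exact: FF'.
by apply: eq_bigr => i _; apply: IH => w sw; apply: FF'; rewrite /= sw.
Qed.

Lemma wsum_sum (V : nmodType) N (I : Type) (r : seq I)
    (F : I -> seq 'I_n -> V) :
  wsum N (fun w => \sum_(k <- r) F k w) = \sum_(k <- r) wsum N (F k).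
Proof.
elim: N F => [//|N IH] F /=; rewrite exchange_big /=.
by apply: eq_bigr => i _; rewrite IH.
Qed.

Lemma wsumD (V : nmodType) N (F F' : seq 'I_n -> V) :
  wsum N (fun w => F w + F' w) = wsum N F + wsum N F'.
Proof.
elim: N F F' => [//|N IH] F F' /=; rewrite -big_split /=.
by apply: eq_bigr => i _; rewrite IH.
Qed.

Lemma wsum_morph (U V : nmodType) (L : U -> V) N (F : seq 'I_n -> U) :
  L 0 = 0 -> {morph L : x y / x + y} ->
  L (wsum N F) = wsum N (fun w => L (F w)).
Proof.
move=> L0 LD; elim: N F => [//|N IH] F /=; rewrite (big_morph L LD L0).
by apply: eq_bigr => i _; rewrite IH.
Qed.

Lemma wsumZ (R : pzRingType) (V : lmodType R) (a : R) N (F : seq 'I_n -> V) :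
  wsum N (fun w => a *: F w) = a *: wsum N F.
Proof. by rewrite -wsum_morph ?scaler0//; exact: scalerDr. Qed.

Lemma wsumB (V : zmodType) N (F F' : seq 'I_n -> V) :
  wsum N (fun w => F w - F' w) = wsum N F - wsum N F'.
Proof. by rewrite wsumD -(@wsum_morph _ _ -%R) ?oppr0//; exact: opprD. Qed.

Lemma ler_norm_wsum (R : realType) (V : normedModType R) N
    (F : seq 'I_n -> V) (B : seq 'I_n -> R) :
  (forall w, size w = N -> `|F w| <= B w) -> `|wsum N F| <= wsum N B.
Proof.
elim: N F B => [|N IH] F B FB /=; first exact: FB.
apply: le_trans (ler_norm_sum _ _ _) _; apply: ler_sum => i _.
by apply: IH => w sw; apply: FB; rewrite /= sw.
Qed.

Lemma wsum_ge0 (R : realType) N (B : seq 'I_n -> R) :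
  (forall w, 0 <= B w) -> 0 <= wsum N B.
Proof.
elim: N B => [|N IH] B B0 /=; first exact: B0.
by apply: sumr_ge0 => i _; apply: IH.
Qed.

(** Summing over a word and a place to cut it is summing over the lengths of
the two pieces and over the pieces: this is the Cauchy product of formal
series, degree by degree. *)
Lemma wsum_split (V : nmodType) N (F : seq 'I_n -> seq 'I_n -> V) :
  wsum N (fun w => \sum_(k < N.+1) F (take k w) (drop k w)) =
  \sum_(k < N.+1) wsum k (fun u => wsum (N - k) (F u)).
Proof.
elim: N F => [|N IH] F; first by rewrite /= !big_ord1.
rewrite [RHS]big_ord_recl [LHS]/= subn0.
under eq_bigr => i _.
  under eq_wsum => w _ do rewrite big_ord_recl /=.
  rewrite wsumD (IH (fun u => F (i :: u))).
  over.
rewrite big_split /=; congr (_ + _); rewrite exchange_big /=.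
by apply: eq_bigr => k _; rewrite subSS.
Qed.

(** The weights are those of the linear series in the single letter [i], and
vanish unless [u] is a power of [i]. *)
Lemma wsum_const_letter (R : pzRingType) (V : lmodType R) (delta : R) i k
    (F : seq 'I_n -> V) :
  wsum k (fun u => (\prod_(j <- u) (delta * (j == i)%:R)) *: F u) =
  delta ^+ k *: F (nseq k i).
Proof.
elim: k F => [|k IH] F /=; first by rewrite big_nil.
rewrite (bigD1 i) //= big1 ?addr0 => [|j ji]; last first.
  rewrite (@eq_wsum _ _ _ (fun=> 0 *: 0)) ?wsumZ ?scale0r// => w _.
  by rewrite big_cons (negbTE ji) mulr0 mul0r !scale0r.
under eq_wsum => w _ do rewrite big_cons eqxx mulr1 -scalerA.
by rewrite wsumZ (IH (fun u => F (i :: u))) scalerA exprS.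
Qed.

End WordSum.

Lemma sum_triangle (V : nmodType) p (F : nat -> nat -> V) :
  \sum_(N < p) \sum_(k < N.+1) F (N - k)%N k =
  \sum_(M < p) \sum_(k < p - M) F M k.
Proof.
elim: p => [|p IH]; first by rewrite !big_ord0.
rewrite big_ord_recr /= IH [RHS]big_ord_recr /= subSnn big_ord1.
under [in RHS]eq_bigr => M _ do rewrite subSn ?(ltnW (ltn_ord M))// big_ord_recr /=.
rewrite big_split /= -addrA; congr (_ + _).
rewrite (reindex_inj rev_ord_inj) big_ord_recr /= subSS subnn subn0 addrC.
rewrite addrC; congr (_ + _).
by apply: eq_bigr => k _; rewrite subSS subKn// ltnW.
Qed.

(** * Taylor expansion of a semigroup *)

(** A mean value inequality for [phi] whose right difference quotients are
bounded by [M], up to an error that is uniform in time: cutting [[0, t]] into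
equal steps shorter than [delta] and adding the increments bounds the total by
[t * (M + e)]. *)
Lemma norm_increments_le (R : realType) (V : normedModType R)
    (phi : R -> V) (t M : R) : 0 <= t ->
  (forall e : R, 0 < e -> exists2 delta : R, 0 < delta &
    forall s h, 0 <= s -> 0 < h -> h < delta -> s + h <= t ->
      `|phi (s + h) - phi s| <= h * (M + e)) ->
  `|phi t - phi 0| <= t * M.
Proof.
rewrite le0r => /predU1P[-> _|t0 inc]; first by rewrite subrr normr0 mul0r.
apply/ler_addgt0Pr => e e0.
have [delta d0 incd] := inc (e / t) (divr_gt0 e0 t0).
have [N tN] : exists N : nat, t / N.+1%:R < delta.
  exists (Num.bound (t / delta)).
  rewrite ltr_pdivrMr// mulrC -ltr_pdivrMr//.
  apply: lt_trans (archi_boundP _) _; first by rewrite divr_ge0// ltW.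
  by rewrite ltr_nat.
pose h := t / N.+1%:R.
have h0 : 0 < h by rewrite divr_gt0.
have step k : (k <= N.+1)%N ->
    `|phi (k%:R * h) - phi 0| <= k%:R * h * (M + e / t).
  elim: k => [|k IH] kN; first by rewrite !mul0r subrr normr0.
  have -> : phi (k.+1%:R * h) - phi 0 =
      (phi (k%:R * h + h) - phi (k%:R * h)) + (phi (k%:R * h) - phi 0).
    by rewrite addrA subrK -natr1 mulrDl mul1r.
  apply: le_trans (ler_normD _ _) _.
  rewrite -natr1 mulrDl mul1r [in leRHS]addrC mulrDl.
  apply: lerD; last by apply: IH; exact: ltnW.
  apply: incd => //; first by rewrite mulr_ge0// ltW.
  rewrite -[X in _ + X]mul1r -mulrDl natr1 /h mulrCA ler_piMr// ?(ltW t0)//.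
  by rewrite ler_pdivrMr// mul1r ler_nat.
have := step N.+1 (leqnn _).
rewrite /h mulrCA divff ?pnatr_eq0// mulr1 mulrDr [t * (e / t)]mulrCA.
by rewrite divff ?gt_eqF// mulr1.
Qed.

(** The error in differentiating a power from the right is quadratic in [h],
uniformly on [[0, t]].  The induction uses
[(s + h) * (s ^+ i.+1 + i.+1 * h * s ^+ i)
 = s ^+ i.+2 + i.+2 * h * s ^+ i.+1 + i.+1 * s ^+ i * h ^+ 2]. *)
Lemma pow_increment_le (R : realType) (t : R) i : exists2 C : R, 0 <= C &
  forall s h, 0 <= s -> 0 <= h -> s + h <= t ->
    `|(s + h) ^+ i.+1 - s ^+ i.+1 - i.+1%:R * h * s ^+ i| <= C * h ^+ 2.
Proof.
elim: i => [|i [C C0 IH]].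
  exists 0 => // s h s0 h0 sh; rewrite !expr1 expr0.
  have -> : s + h - s - 1 * h * 1 = 0 by ring.
  by rewrite normr0 mul0r.
exists (`|t| * C + i.+1%:R * `|t| ^+ i) => [|s h s0 h0 sh].
  by rewrite addr_ge0 ?mulr_ge0 ?exprn_ge0.
have st : s <= `|t|.
  by apply: le_trans (ler_norm t); apply: le_trans sh; rewrite lerDl.
have sht : s + h <= `|t| by apply: le_trans (ler_norm t).
have -> : (s + h) ^+ i.+2 - s ^+ i.+2 - i.+2%:R * h * s ^+ i.+1 =
    (s + h) * ((s + h) ^+ i.+1 - s ^+ i.+1 - i.+1%:R * h * s ^+ i) +
    i.+1%:R * s ^+ i * h ^+ 2.
  by rewrite !exprS -(@natr1 _ i.+1); ring.
apply: le_trans (ler_normD _ _) _; rewrite [leRHS]mulrDl; apply: lerD.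
  rewrite normrM ger0_norm ?addr_ge0// -[leRHS]mulrA.
  by apply: ler_pM => //; [exact: addr_ge0 | exact: IH].
rewrite ger0_norm ?mulr_ge0 ?exprn_ge0//.
apply: ler_wpM2r; first exact: sqr_ge0.
by apply: ler_wpM2l => //; apply: lerXn2r; rewrite ?nnegrE.
Qed.

Definition growth_le (R : realType) (V : normedModType R)
    (S : c0_semigroup V) (om : R) : Prop :=
  forall t, 0 <= t -> forall x, `|S t x| <= expR (om * t) * `|x|.

Section OneSemigroup.
Variables (R : realType) (V : normedModType R) (S : c0_semigroup V).
Local Notation G := (generator S).

Lemma sg_0 t : 0 <= t -> S t 0 = 0.
Proof.
move=> t0; have := sg_linear S t0 (-1) 0 0.
by rewrite scaler0 addr0 scaleN1r addNr.
Qed.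

Lemma sgDr t : 0 <= t -> {morph S t : x y / x + y}.
Proof. by move=> t0 x y; have := sg_linear S t0 1 x y; rewrite !scale1r. Qed.

Lemma sgZ t a x : 0 <= t -> S t (a *: x) = a *: S t x.
Proof.
by move=> t0; have := sg_linear S t0 a x 0; rewrite sg_0// !addr0.
Qed.

Lemma sgBr t : 0 <= t -> {morph S t : x y / x - y}.
Proof. by move=> t0 x y; rewrite sgDr// -scaleN1r sgZ// scaleN1r. Qed.

Lemma generator_o x (e : R) : dom G x -> 0 < e ->
  exists2 delta : R, 0 < delta & forall h, 0 < h -> h < delta ->
    `|S h x - x - h *: G x| <= h * e.
Proof.
move=> dx e0; have : h^-1 *: (S h x - x) @[h --> 0^'+] --> G x by exact: dx.
move=> /cvgrPdist_le /(_ _ e0) [delta /= d0 near_e]; exists delta => // h h0 hd.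
have := near_e h; rewrite /= sub0r normrN gtr0_norm// => /(_ hd h0) le_e.
have -> : S h x - x - h *: G x = - (h *: (G x - h^-1 *: (S h x - x))).
  by rewrite scalerBr scalerA divff ?gt_eqF// scale1r opprB.
by rewrite normrN normrZ gtr0_norm// ler_pM2l.
Qed.

(** The powers of an operator apply the generator last; the Taylor expansion of
[x] is differentiated into that of [generator S x], which needs it first. *)
Lemma op_powSr q x : dom (op_pow G q.+1) x ->
  [/\ dom G x, dom (op_pow G q) (G x) &
      op_pow G q.+1 x = op_pow G q (G x)].
Proof.
elim: q => [[_ dx]//|q IH] [dq dGq].
by have [dx dqx e] := IH dq; split => //; [split; rewrite -?e | congr (G _)].
Qed.

(** The right derivative of the remainder of order [q.+1] of [x] is the
remainder of order [q] of [G x], so that induction on [q] and the mean value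
inequality give the bound; the factor [1 / q!] of the sharp estimate is lost
because the bound on the derivative is taken at the final time. *)
Lemma taylor_remainder (om : R) : 0 <= om -> growth_le S om ->
  forall q t x, 0 <= t -> dom (op_pow G q) x ->
  `|S t x - \sum_(i < q) (t ^+ i / i`!%:R) *: op_pow G i x| <=
  expR (om * t) * t ^+ q * `|op_pow G q x|.
Proof.
move=> om0 growS; elim=> [|q IH] t x t0 dx.
  by rewrite big_ord0 subr0 expr0 mulr1; exact: growS.
have [dGx dqG ->] := op_powSr dx.
have eG i : (i < q.+1)%N -> op_pow G i.+1 x = op_pow G i (G x).
  by rewrite ltnS => iq; case: (@op_powSr i x) => //; apply: (@dom_powS _ _ _ q.+1).
pose phi s := S s x - \sum_(i < q.+1) (s ^+ i / i`!%:R) *: op_pow G i x.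
have phi0 : phi 0 = 0.
  rewrite /phi sg0 big_ord_recl /= expr0 fact0 divr1 scale1r big1 ?addr0 ?subrr//.
  by move=> i _; rewrite expr0n mul0r scale0r.
have -> : `|S t x - \sum_(i < q.+1) (t ^+ i / i`!%:R) *: op_pow G i x| =
  `|phi t - phi 0| by rewrite phi0 subr0.
have -> : expR (om * t) * t ^+ q.+1 * `|op_pow G q (G x)| =
   t * (expR (om * t) * t ^+ q * `|op_pow G q (G x)|) by rewrite exprS; ring.
apply: norm_increments_le => // e e0.
have e2 : 0 < e / 2 / expR (om * t) by rewrite !divr_gt0 ?expR_gt0.
have [d1 d1_gt0 le1] := generator_o dGx e2.
have /choice [C HC] i : exists C : R, 0 <= C /\ forall s h, 0 <= s -> 0 <= h ->
    s + h <= t ->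
    `|(s + h) ^+ i.+1 - s ^+ i.+1 - i.+1%:R * h * s ^+ i| <= C * h ^+ 2.
  by have [C] := pow_increment_le t i; exists C.
pose D := \sum_(i < q) C i * `|op_pow G i (G x)|.
have D0 : 0 <= D by apply: sumr_ge0 => i _; rewrite mulr_ge0//; case: (HC i).
exists (Num.min d1 (e / 2 / (D + 1))).
  by rewrite lt_min d1_gt0 !divr_gt0// ltr_wpDl.
move=> s h s0 h0; rewrite lt_min => /andP[hd1 hd2] sht.
have st : s <= t by apply: le_trans sht; rewrite lerDl ltW.
have h_ge0 := ltW h0.
(* The error of [S] at the origin carried along by [S s], then [h] times the
   remainder of lower order, then the quadratic errors on the monomials. *)
have -> : phi (s + h) - phi s = S s (S h x - x - h *: G x) +
    h *: (S s (G x) - \sum_(i < q) (s ^+ i / i`!%:R) *: op_pow G i (G x)) -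
    \sum_(i < q) (((s + h) ^+ i.+1 - s ^+ i.+1 - i.+1%:R * h * s ^+ i)
       / i.+1`!%:R) *: op_pow G i (G x).
  have -> : \sum_(i < q) (((s + h) ^+ i.+1 - s ^+ i.+1 - i.+1%:R * h * s ^+ i)
       / i.+1`!%:R) *: op_pow G i (G x) =
     \sum_(i < q) ((s + h) ^+ i.+1 / i.+1`!%:R) *: op_pow G i.+1 x
     - \sum_(i < q) (s ^+ i.+1 / i.+1`!%:R) *: op_pow G i.+1 x
     - h *: \sum_(i < q) (s ^+ i / i`!%:R) *: op_pow G i (G x).
    rewrite scaler_sumr -!sumrB; apply: eq_bigr => i _.
    rewrite eG ?(ltn_trans (ltn_ord i))// scalerA -2!scalerBl; congr (_ *: _).
    rewrite factS natrM; field.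
    by rewrite nat1r !pnatr_eq0 -lt0n fact_gt0.
  rewrite /phi !big_ord_recl /= !expr0 fact0 divr1 !scale1r sgD// !sgBr// sgZ//.
  rewrite scalerBr.
  have swap (u v b c : V) : u - v - (b - c) = u - b - (v - c).
    by rewrite !opprD !opprK addrACA.
  have cancel (u v b : V) : u - b - (v - b) = u - v by rewrite opprB addrA subrK.
  have regroup (u v w y a b c : V) : u - (y + a) - (v - (y + b)) =
      u - v - w + (w - c) - (a - b - c).
    by rewrite [u - v - w + _]addrA subrK cancel swap [y + a]addrC addrKA.
  exact: regroup.
apply: le_trans (ler_normB _ _) _.
have -> : h * (expR (om * t) * t ^+ q * `|op_pow G q (G x)| + e) =
  h * (e / 2) + h * (expR (om * t) * t ^+ q * `|op_pow G q (G x)|) + h * (e / 2).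
  by field.
apply: lerD.
  apply: le_trans (ler_normD _ _) _; apply: lerD.
    apply: le_trans (growS _ s0 _) _.
    apply: le_trans (_ : expR (om * t) * (h * (e / 2 / expR (om * t))) <= _).
      apply: ler_pM; rewrite ?expR_ge0//.
        by rewrite ler_expR ler_wpM2l.
      exact: le1.
    by rewrite le_eqVlt; apply/orP; left; apply/eqP; field; rewrite gt_eqF// expR_gt0.
  rewrite normrZ gtr0_norm// ler_pM2l//; apply: le_trans (IH _ _ s0 dqG) _.
  apply: ler_wpM2r => //; apply: ler_pM; rewrite ?expR_ge0 ?exprn_ge0//.
    by rewrite ler_expR ler_wpM2l.
  by apply: lerXn2r; rewrite ?nnegrE.
apply: le_trans (_ : h ^+ 2 * D <= _).
  rewrite mulr_sumr; apply: le_trans (ler_norm_sum _ _ _) _.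
  apply: ler_sum => i _; rewrite normrZ mulrA; apply: ler_wpM2r => //.
  have [Ci0 leC] := HC i.
  rewrite normrM mulrC [`|_^-1|]gtr0_norm ?invr_gt0 ?ltr0n ?fact_gt0//.
  rewrite ler_pdivrMl ?ltr0n ?fact_gt0//.
  rewrite [h ^+ 2 * _]mulrC; apply: le_trans (leC _ _ s0 h_ge0 sht) _.
  by rewrite ler_peMl ?mulr_ge0 ?sqr_ge0// ler1n fact_gt0.
rewrite expr2 -mulrA ler_pM2l//; move: hd2.
rewrite ltr_pdivlMr ?ltr_wpDl// => hd2; apply: le_trans (ltW hd2).
by rewrite ler_pM2l// lerDl.
Qed.

End OneSemigroup.

(** * Words in the generators *)

Lemma op_prod_cat (V : Type) (As Bs : seq (partial_op V)) x :
  op_prod (As ++ Bs) x = op_prod As (op_prod Bs x).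
Proof.
by elim: As => [//|A As IH] /=; rewrite -!/(op_prod _) in IH *; rewrite IH.
Qed.

Lemma dom_op_prod_cat (V : Type) (As Bs : seq (partial_op V)) x :
  dom (op_prod (As ++ Bs)) x ->
  dom (op_prod Bs) x /\ dom (op_prod As) (op_prod Bs x).
Proof.
elim: As => [//|A As IH] [/IH[dB dA]].
by rewrite -/(op_prod _) op_prod_cat.
Qed.

Section Family.
Variables (R : realType) (V : normedModType R) (n : nat).
Variable S : 'I_n.+1 -> c0_semigroup V.
Local Notation Gj := (fun j => generator (S j)).
Local Notation gen_word w := (op_prod (map Gj w)).

Definition words_dom q : set V := [set x |
  forall w : seq 'I_n.+1, size w = q -> dom (gen_word w) x].

(** Operators are composed on their natural domains, so that a vector in the
domain of a word is in the domain of each suffix; shorter words are reached by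
padding on the left with an arbitrary letter. *)
Lemma words_dom_le q x w :
  words_dom q x -> (size w <= q)%N -> dom (gen_word w) x.
Proof.
move=> dx wq.
have := dx (nseq (q - size w) ord0 ++ w).
rewrite size_cat size_nseq subnK// map_cat => /(_ erefl) d_cat.
by have [] := dom_op_prod_cat d_cat.
Qed.

Lemma gen_word_nseq k i w q x : words_dom q x -> (k + size w <= q)%N ->
  dom (op_pow (generator (S i)) k) (gen_word w x) /\
  op_pow (generator (S i)) k (gen_word w x) = gen_word (nseq k i ++ w) x.
Proof.
move=> dx kw.
have := @words_dom_le _ _ (nseq k i ++ w) dx; rewrite size_cat size_nseq => /(_ kw).
rewrite map_cat map_nseq => d_cat; have [_ dk] := dom_op_prod_cat d_cat.
split=> //.
by rewrite op_prod_cat.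
Qed.

Lemma generator_wsum (A : c0_semigroup V) N (F : seq 'I_n.+1 -> V) :
  (forall w, size w = N -> dom (generator A) (F w)) ->
  dom (generator A) (wsum N F) /\
  generator A (wsum N F) = wsum N (fun w => generator A (F w)).
Proof.
elim: N F => [|N IH] F dF; first by split; [exact: dF|].
have {}IH i : dom (generator A) (wsum N (fun w => F (i :: w))) /\
    generator A (wsum N (fun w => F (i :: w))) =
    wsum N (fun w => generator A (F (i :: w))).
  by apply: IH => w sw; apply: dF; rewrite /= sw.
have sumP (r : seq 'I_n.+1) (H : 'I_n.+1 -> V) :
    (forall i, dom (generator A) (H i)) ->
    dom (generator A) (\sum_(i <- r) H i) /\
    generator A (\sum_(i <- r) H i) = \sum_(i <- r) generator A (H i).
  move=> dH; elim: r => [|i r [dr er]]; first by rewrite !big_nil; exact: gen0.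
  have [] := dom_genZD 1 (dH i) dr.
  by rewrite !scale1r !big_cons er.
have [|d e] := sumP (index_enum _) (fun i => wsum N (fun w => F (i :: w))).
  by move=> i; case: (IH i).
split; first exact: d.
by apply: (eq_trans e); apply: eq_bigr => i _; case: (IH i).
Qed.

(** The noncommutative binomial expansion of the power of a sum.  Domains
matter: a generator is applied to a sum of vectors that must each be in its
domain, which is what [words_dom] provides. *)
Lemma op_pow_sum_words q i x : words_dom q x -> (i <= q)%N ->
  op_pow (op_sum Gj) i x = wsum i (fun w => gen_word w x).
Proof.
move=> dx; elim: i => [//|i IH] iq.
transitivity (\sum_j generator (S j) (op_pow (op_sum Gj) i x)) => //.
rewrite IH ?(ltnW iq)//; apply: eq_bigr => j _.
have [|_ e] := @generator_wsum (S j) i (fun w => gen_word w x); last exact: e.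
by move=> w sw; case: (@words_dom_le _ _ (j :: w) dx); rewrite //= sw.
Qed.

Lemma sg_wsum (A : c0_semigroup V) t N (F : seq 'I_n.+1 -> V) : 0 <= t ->
  A t (wsum N F) = wsum N (fun w => A t (F w)).
Proof. by move=> t0; apply: wsum_morph; [exact: sg_0|exact: sgDr]. Qed.

Lemma sg_sum (A : c0_semigroup V) t (I : Type) (r : seq I) (F : I -> V) :
  0 <= t -> A t (\sum_(i <- r) F i) = \sum_(i <- r) A t (F i).
Proof. by move=> t0; rewrite (big_morph _ (sgDr A t0) (sg_0 A t0)). Qed.

(** * Expansion and stability of a splitting *)

Definition block_series (b : seq (R * 'I_n.+1)) : fseries R n.+1 :=
  fs_prod [seq fs_exp (fun v => c.1 * fs_var R c.2 v) | c <- b].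

Definition block_op (b : seq (R * 'I_n.+1)) (h : R) (x : V) : V :=
  foldr (fun c y => S c.2 (c.1 * h) y) x b.

(** An exponential in front of a block multiplies its series by powers of a
single letter only, which reduces the Cauchy product to a sum over the
exponent of that letter. *)
Lemma wsum_block_cons delta i b N (F : seq 'I_n.+1 -> V) :
  wsum N (fun w => block_series ((delta, i) :: b) w *: F w) =
  \sum_(k < N.+1) (delta ^+ k / k`!%:R) *:
    wsum (N - k) (fun v => block_series b v *: F (nseq k i ++ v)).
Proof.
pose e := fs_exp (fun v => delta * fs_var R i v).
transitivity (wsum N (fun w => \sum_(k < N.+1)
    (e (take k w) * block_series b (drop k w)) *: F (take k w ++ drop k w))).
  apply: eq_wsum => w sw; rewrite /block_series /= /fs_mul sw scaler_suml.
  by apply: eq_bigr => k _; rewrite cat_take_drop.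
rewrite (wsum_split N (fun u v => (e u * block_series b v) *: F (u ++ v))).
apply: eq_bigr => k _.
under eq_wsum => u su.
  under eq_wsum => v _ do rewrite -scalerA.
  rewrite wsumZ /e (@fs_exp_linear _ _ (fun j => delta * (j == i)%:R)); first last.
  - by move=> j; rewrite /fs_var eqseq_cons andbT.
  - move=> v; rewrite /fs_var.
    by case: (eqVneq v [:: i]) => [->//|]; rewrite mulr0.
  rewrite su -scalerA.
  over.
rewrite wsumZ (wsum_const_letter _ _ _ (fun u => wsum _ (fun v => _ *: F (u ++ v)))).
by rewrite scalerA mulrC.
Qed.

(** The value at [x] of the formal series [a], truncated at degree [q], when the
letters become [h] times the generators. *)
Definition word_taylor (a : fseries R n.+1) q (h : R) (x : V) : V :=
  \sum_(N < q) h ^+ N *: wsum N (fun w => a w *: gen_word w x).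

Section Expansion.
Variables (om T B : R) (q : nat).
Hypothesis om_ge0 : 0 <= om.
Hypothesis growS : forall j, growth_le (S j) om.
Hypothesis B_ge0 : 0 <= B.

Definition words_bounded : set V := [set x | words_dom q x /\
  forall w : seq 'I_n.+1, size w = q -> `|gen_word w x| <= B].

(** Induction on the factors.  The new outermost factor [S i] is a bounded
operator, so it preserves the error made so far.  It then meets the
truncated series term by term: a term of degree [M] is expanded by Taylor's
formula to order [q - M], which brings all the remainders to order [q] in [h]
and to words of length exactly [q]. *)
Lemma block_op_expansion b : all (fun c => 0 <= c.1) b ->
  exists2 K : R, 0 <= K & forall h x, 0 <= h <= T -> words_bounded x ->
    `|block_op b h x - word_taylor (block_series b) q h x| <= K * h ^+ q.
Proof.
elim: b => [_|[delta i] b IH /= /andP[delta0 /IH[K K0 {}IH]]].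
  (* for [q = 0] the truncated series is 0, and the error is [x] itself *)
  have [q0|q_gt0] := posnP q.
    exists B => // h x hT [_ Bx].
    by rewrite /word_taylor q0 big_ord0 subr0 expr0 mulr1; apply: (Bx [::]).
  exists 0 => // h x hT _; rewrite /word_taylor mul0r.
  case: q q_gt0 => // q' _; rewrite big_ord_recl big1 => [|N _].
    by rewrite /block_series /= /fs_one eqxx expr0 !scale1r addr0 subrr normr0.
  rewrite (@eq_wsum _ _ _ _ (fun=> 0 *: 0)) ?wsumZ ?scale0r ?scaler0// => w sw.
  by rewrite /block_series /= /fs_one -size_eq0 sw scale0r.
pose E := expR (om * (delta * T)).
have E0 : 0 <= E by exact: expR_ge0.
pose K' := \sum_(M < q) wsum M
  (fun v => `|block_series b v| * (E * delta ^+ (q - M) * B)).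
exists (E * K + K') => [|h x /andP[h0 hT] [dx Bx]].
  rewrite addr_ge0 ?mulr_ge0//; apply: sumr_ge0 => M _; apply: wsum_ge0 => v.
  by rewrite !mulr_ge0// exprn_ge0.
have dh0 : 0 <= delta * h by exact: mulr_ge0.
have leE : expR (om * (delta * h)) <= E by rewrite ler_expR !ler_wpM2l.
set y := block_op b h x.
pose z := word_taylor (block_series b) q h x.
rewrite -/(block_op b h x) -/y -[S i _ y](subrK (S i (delta * h) z)).
rewrite -sgBr// -addrA mulrDl; apply: le_trans (ler_normD _ _) _; apply: lerD.
  apply: le_trans (growS i dh0 _) _; rewrite -mulrA.
  by apply: ler_pM; rewrite ?expR_ge0// IH// h0.
have -> : word_taylor (block_series ((delta, i) :: b)) q h x =
    \sum_(M < q) h ^+ M *: wsum M (fun v => block_series b v *: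
      \sum_(k < q - M) ((delta * h) ^+ k / k`!%:R) *:
        op_pow (generator (S i)) k (gen_word v x)).
  (* the terms by degree [M] in the block and exponent [k] of the new letter *)
  pose F M k := h ^+ (M + k) *: ((delta ^+ k / k`!%:R) *:
    wsum M (fun v => block_series b v *: gen_word (nseq k i ++ v) x)).
  transitivity (\sum_(N < q) \sum_(k < N.+1) F (N - k)%N k).
    apply: eq_bigr => N _.
    rewrite (wsum_block_cons _ _ _ _ (fun w => gen_word w x)) scaler_sumr.
    by apply: eq_bigr => k _; rewrite /F subnK// -ltnS.
  rewrite sum_triangle; apply: eq_bigr => M _.
  under [in RHS]eq_wsum => v _ do rewrite scaler_sumr.
  rewrite wsum_sum scaler_sumr; apply: eq_bigr => k _.
  rewrite /F exprD -scalerA; congr (_ *: _); rewrite scalerA -wsumZ.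
  apply: eq_wsum => v sv; rewrite !scalerA.
  have [|_ ->] := @gen_word_nseq k i v q x dx.
    by rewrite sv addnC ltnW// -ltn_subRL.
  by congr (_ *: _); rewrite exprMn; ring.
rewrite /z /word_taylor sg_sum// -sumrB mulr_suml.
apply: le_trans (ler_norm_sum _ _ _) _; apply: ler_sum => M _.
rewrite sgZ// sg_wsum// -scalerBr -wsumB normrZ ger0_norm ?exprn_ge0//.
have hq : h ^+ q = h ^+ M * h ^+ (q - M) by rewrite -exprD subnKC// ltnW.
rewrite hq [leRHS]mulrC -[leRHS]mulrA ler_wpM2l ?exprn_ge0//.
rewrite (@wsum_morph _ _ _ ( *%R (h ^+ (q - M)))) ?mulr0//; last exact: mulrDr.
apply: ler_norm_wsum => v sv.
rewrite sgZ// -scalerBr normrZ mulrCA ler_wpM2l//.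
have [|dv ev] := @gen_word_nseq (q - M) i v q x dx.
  by rewrite sv subnK// ltnW.
apply: le_trans (taylor_remainder om_ge0 (growS i) dh0 dv) _.
rewrite ev exprMn.
have -> : h ^+ (q - M) * (E * delta ^+ (q - M) * B) =
    E * (delta ^+ (q - M) * h ^+ (q - M)) * B by ring.
apply: ler_pM; rewrite ?mulr_ge0 ?expR_ge0 ?exprn_ge0//.
  by rewrite ler_wpM2r// mulr_ge0// exprn_ge0.
by apply: Bx; rewrite size_cat size_nseq sv subnK// ltnW.
Qed.

Lemma splitting_op_expansion Q : nonneg_splitting Q ->
  exists2 K : R, 0 <= K & forall h x, 0 <= h <= T -> words_bounded x ->
    `|splitting_op Q S h x - word_taylor (splitting_series Q) q h x|
    <= K * h ^+ q.
Proof.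
elim: Q => [_|[lam b] Q IH /= /andP[/andP[/= lam0 b0] /IH[K K0 {}IH]]].
  exists 0 => // h x _ _; rewrite /splitting_op big_nil /word_taylor big1 => [|N _].
    by rewrite subrr normr0 mul0r.
  rewrite (@eq_wsum _ _ _ _ (fun=> 0 *: 0)) ?wsumZ ?scale0r ?scaler0// => w sw.
  by rewrite /splitting_series big_nil scale0r.
have [Kb Kb0 Hb] := block_op_expansion b0.
exists (lam * Kb + K) => [|h x hT Bx]; first by rewrite addr_ge0 ?mulr_ge0.
have -> : word_taylor (splitting_series ((lam, b) :: Q)) q h x =
    lam *: word_taylor (block_series b) q h x +
    word_taylor (splitting_series Q) q h x.
  rewrite scaler_sumr -big_split; apply: eq_bigr => N _ /=.
  rewrite scalerA mulrC -scalerA -scalerDr; congr (_ *: _).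
  rewrite -wsumZ -wsumD; apply: eq_wsum => w _.
  by rewrite /splitting_series big_cons /= scalerDl scalerA.
rewrite /splitting_op big_cons /= -/(splitting_op Q S h x) -/(block_op b h x).
rewrite opprD addrACA -scalerBr mulrDl; apply: le_trans (ler_normD _ _) _.
by apply: lerD; [rewrite normrZ ger0_norm// -mulrA ler_wpM2l//; exact: Hb|exact: IH].
Qed.

End Expansion.

Section Stability.
Variable om : R.
Hypothesis om_ge0 : 0 <= om.
Hypothesis growS : forall j, growth_le (S j) om.

Lemma block_opB b h : all (fun c => 0 <= c.1) b -> 0 <= h ->
  {morph block_op b h : x y / x - y}.
Proof.
move=> + h0 x y; elim: b => [//|c b IH] /= /andP[c0 /IH {}IH].
by rewrite -/(block_op b h _) IH sgBr// mulr_ge0.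
Qed.

Lemma block_op_growth b h x : all (fun c => 0 <= c.1) b -> 0 <= h ->
  `|block_op b h x| <= expR (om * (\sum_(c <- b) c.1) * h) * `|x|.
Proof.
move=> + h0; elim: b => [_|c b IH] /=.
  by rewrite big_nil mulr0 mul0r expR0 mul1r.
move=> /andP[c0 /IH {}IH]; rewrite -/(block_op b h x) big_cons.
have ch0 : 0 <= c.1 * h by exact: mulr_ge0.
apply: le_trans (growS _ ch0 _) _.
rewrite mulrDr mulrDl expRD -!mulrA ler_wpM2l ?expR_ge0//.
by rewrite mulrA.
Qed.

Definition splitting_rate (Q : splitting R n.+1) : R :=
  om * \sum_(b <- Q) \sum_(c <- b.2) c.1.

Lemma splitting_opB Q h : nonneg_splitting Q -> 0 <= h ->
  {morph splitting_op Q S h : x y / x - y}.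
Proof.
move=> /allP Q0 h0 x y; rewrite /splitting_op -sumrB.
apply: eq_big_seq => b /Q0 /andP[_ b0].
by rewrite -scalerBr -!/(block_op _ _ _) block_opB.
Qed.

(** A convex combination of products of semigroups; the rate adds up all the
durations of all the blocks, which is a crude common bound for each block. *)
Lemma splitting_op_growth Q h x : nonneg_splitting Q ->
  \sum_(b <- Q) b.1 = 1 -> 0 <= h ->
  `|splitting_op Q S h x| <= expR (splitting_rate Q * h) * `|x|.
Proof.
move=> /allP Q0 Q1 h0; apply: le_trans (ler_norm_sum _ _ _) _.
rewrite -[leRHS]mul1r -Q1 mulr_suml big_seq [leRHS]big_seq.
apply: ler_sum => b bQ; have /andP[lam0 b0] := Q0 b bQ.
rewrite -/(block_op _ _ _) normrZ ger0_norm// ler_wpM2l//.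
apply: le_trans (block_op_growth _ b0 h0) _.
rewrite ler_wpM2r// ler_expR ler_wpM2r// ler_wpM2l//.
have sum0 (b' : R * seq (R * 'I_n.+1)) : b' \in Q -> 0 <= \sum_(c <- b'.2) c.1.
  by move=> /Q0 /andP[_ /allP b'0]; rewrite big_seq sumr_ge0// => c /b'0.
rewrite (big_rem b)//= lerDl big_seq sumr_ge0// => b' /mem_rem; exact: sum0.
Qed.

End Stability.
End Family.

(** * Stability and consistency give convergence *)

(** Lady Windermere's fan: each step adds a local error [e] and amplifies the
earlier ones by the Lipschitz constant [rho] of [L]. *)
Lemma iter_error (R : realType) (V : normedModType R) (L : V -> V)
    (rho e : R) (U : nat -> V) n : 1 <= rho -> 0 <= e ->
  (forall x y, `|L x - L y| <= rho * `|x - y|) ->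
  (forall k, (k < n)%N -> `|U k.+1 - L (U k)| <= e) ->
  `|U n - iter n L (U 0%N)| <= n%:R * rho ^+ n * e.
Proof.
move=> rho1 e0 lipL; have rho0 : 0 <= rho by apply: le_trans rho1.
elim: n => [_|n IH step]; first by rewrite subrr normr0 !mul0r.
rewrite iterS -(subrK (L (U n)) (U n.+1)) -addrA.
apply: le_trans (ler_normD _ _) _.
rewrite -[n.+1%:R]nat1r !mulrDl mul1r; apply: lerD.
  apply: le_trans (step n _) _ => //.
  by rewrite ler_peMl// exprn_ege1.
apply: le_trans (lipL _ _) _; rewrite exprS.
have -> : n%:R * (rho * rho ^+ n) * e = rho * (n%:R * rho ^+ n * e) by ring.
by rewrite ler_wpM2l// IH// => k kn; apply: step; exact: ltnW.
Qed.

Lemma exp_bounded_growth (R : realType) (V : normedModType R)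
    (A : c0_semigroup V) : exp_bounded A ->
  exists2 c : R, 0 <= c & forall om, c <= om -> growth_le A om.
Proof.
move=> [c Hc]; exists `|c| => // om com t t0 x.
apply: le_trans (Hc t t0 x) _; rewrite ler_wpM2r// ler_expR ler_wpM2r//.
by apply: le_trans com; exact: ler_norm.
Qed.

(** The order condition on the empty word: every exponential series has
constant term 1. *)
Lemma classical_order_sum1 (R : realType) n p (Q : splitting R n) :
  classical_order p Q -> \sum_(b <- Q) b.1 = 1.
Proof.
move=> /(_ [::] isT); rewrite fs_exp_sum_var fact0 invr1 => <-.
apply: eq_bigr => b _; rewrite -[LHS]mulr1; congr (_ * _).
elim: b.2 => [//|c l IH] /=; rewrite /fs_mul big_ord1 /= -IH mulr1.
by rewrite /fs_exp big_ord1 /= fact0 invr1 mul1r.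
Qed.

(** The result in its natural setting: nothing but the semigroups and their
generators enters. *)
Theorem splitting_convergence (R : realType) (V : normedModType R) n
    (P : c0_semigroup V) (S : 'I_n.+1 -> c0_semigroup V)
    (T : R) p (Q : splitting R n.+1) (f : V) :
  exp_bounded P -> (forall j, exp_bounded (S j)) ->
  nonneg_splitting Q -> classical_order p Q -> smooth_class P S T p.+1 f ->
  exists C : R, forall (k : nat) (h : R), 0 < h -> k%:R * h <= T ->
    `|P (k%:R * h) f - iter k (splitting_op Q S h) f| <= C * h ^+ p.
Proof.
move=> bP bS Q0 Qp [dG dw [B0 leB] Gsum].
have [cP cP0 growP] := exp_bounded_growth bP.
have /choice [c Hc] j : exists c : R, 0 <= c /\
    forall om, c <= om -> growth_le (S j) om.
  by have [c] := exp_bounded_growth (bS j); exists c.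
pose om := cP + \sum_j c j.
have c0 : 0 <= \sum_j c j by apply: sumr_ge0 => j _; case: (Hc j).
have om0 : 0 <= om by rewrite addr_ge0.
have {}growP : growth_le P om by apply: growP; rewrite lerDl.
have growS j : growth_le (S j) om.
  apply: (Hc j).2; rewrite /om (bigD1 j)//= addrCA lerDl addr_ge0//.
  by apply: sumr_ge0 => i _; case: (Hc i).
pose B := `|B0|; have B_ge0 : 0 <= B by exact: normr_ge0.
have Bw t : 0 <= t <= T -> words_bounded S B p.+1 (P t f).
  move=> tT; split=> w /eqP sw; first exact: (dw t (Tuple sw) tT).
  apply: le_trans (ler_norm B0).
  exact: (leB t (Tuple sw) tT).
have [K K0 leK] := splitting_op_expansion T p.+1 om0 growS B_ge0 Q0.
pose BB := wsum p.+1 (fun _ : seq 'I_n.+1 => B).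
have BB0 : 0 <= BB by apply: wsum_ge0 => ?.
pose D := expR (om * T) * BB + K.
have D0 : 0 <= D by rewrite addr_ge0// mulr_ge0// expR_ge0.
have local t h : 0 <= t <= T -> 0 <= h <= T ->
    `|P h (P t f) - splitting_op Q S h (P t f)| <= D * h ^+ p.+1.
  move=> tT hT; have /andP[h0 hleT] := hT.
  have [dx Bx] := Bw t tT; have [dP _] := dG t tT.
  have powG i : (i <= p.+1)%N -> op_pow (generator P) i (P t f) =
      wsum i (fun w => op_prod [seq generator (S j) | j <- w] (P t f)).
    case: i => [//|i] ip; rewrite (Gsum i.+1 t _ tT).2 ?ip//.
    exact: op_pow_sum_words dx ip.
  pose taylor := \sum_(i < p.+1) (h ^+ i / i`!%:R) *:
    op_pow (generator P) i (P t f).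
  have eqT : word_taylor S (splitting_series Q) p.+1 h (P t f) = taylor.
    apply: eq_bigr => i _; rewrite powG ?(ltnW (ltn_ord i))// -scalerA.
    congr (_ *: _); rewrite -wsumZ; apply: eq_wsum => w sw.
    by rewrite Qp ?fs_exp_sum_var ?sw// -ltnS.
  have := leK h _ hT (Bw t tT); rewrite eqT => expQ.
  rewrite -(subrK taylor (P h _)) -addrA mulrDl.
  apply: le_trans (ler_normD _ _) _; apply: lerD; last by rewrite distrC.
  apply: le_trans (taylor_remainder om0 growP h0 dP) _.
  rewrite powG// -mulrA mulrCA [leRHS]mulrC; apply: ler_wpM2l.
    exact: exprn_ge0.
  apply: ler_pM; rewrite ?expR_ge0//; first by rewrite ler_expR ler_wpM2l.
  by apply: ler_norm_wsum.
pose Om := splitting_rate om Q.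
exists (T * expR (Om * T) * D) => k h h_gt0 khT.
have h0 := ltW h_gt0.
have Om0 : 0 <= Om.
  rewrite mulr_ge0// big_seq sumr_ge0// => b /(allP Q0) /andP[_ /allP b0].
  by rewrite big_seq sumr_ge0// => a /b0.
have rho1 : 1 <= expR (Om * h) by rewrite -expR0 ler_expR mulr_ge0.
have lipQ x y : `|splitting_op Q S h x - splitting_op Q S h y| <=
    expR (Om * h) * `|x - y|.
  rewrite -splitting_opB//.
  exact: splitting_op_growth (classical_order_sum1 Qp) h0.
have step i : (i < k)%N ->
    `|P (i.+1%:R * h) f - splitting_op Q S h (P (i%:R * h) f)| <= D * h ^+ p.+1.
  move=> ik; have ikh : i%:R * h + h <= T.
    by apply: le_trans khT; rewrite -{2}[h]mul1r -mulrDl natr1 ler_wpM2r// ler_nat.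
  have ih0 : 0 <= i%:R * h by rewrite mulr_ge0.
  rewrite -nat1r mulrDl mul1r sgD//; apply: local.
    by rewrite ih0 (le_trans _ ikh)// lerDl.
  by rewrite h0 (le_trans _ ikh)// lerDr.
have e0 : 0 <= D * h ^+ p.+1 by rewrite mulr_ge0// exprn_ge0.
have := iter_error rho1 e0 lipQ step; rewrite mul0r sg0 => /le_trans; apply.
have -> : k%:R * expR (Om * h) ^+ k * (D * h ^+ p.+1) =
  (k%:R * h) * expR (Om * (k%:R * h)) * D * h ^+ p.
  by rewrite -expRM_natl exprS [k%:R * (Om * h)]mulrCA; ring.
apply: ler_wpM2r; first exact: exprn_ge0.
apply: ler_wpM2r => //; apply: ler_pM; rewrite ?expR_ge0 ?mulr_ge0//.
by rewrite ler_expR ler_wpM2l.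
Qed.

(** * The weighted space *)

Theorem proposition7p9
  (R : realType)
  (* the state space and the linear part *)
  (X : completeNormedModType R)
  (hX : hilbert X) (sepX : separable X)
  (S : c0_semigroup X)
  (hS : exp_bounded S)
  (hA : compact_resolvent (generator S))
  (* the coefficients *)
  (m : nat) (hm : (1 <= m)%N)
  (d : nat) (alpha : X -> X) (sigma : 'I_d -> X -> X)
  (alpha_lip : lipschitz alpha)
  (sigma_lip : forall j, lipschitz (sigma j))
  (alpha_lip_dom : forall l, (1 <= l <= m)%N -> lipschitz_dom S l alpha)
  (sigma_lip_dom : forall j l, (1 <= l <= m)%N -> lipschitz_dom S l (sigma j))
  (sigma_C1 : forall j, C1_bounded (sigma j))
  (* the stochastic basis and the driving Brownian motion *)
  (disp : measure_display) (Om : measurableType disp) (Pr : probability Om R)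
  (F : R -> set (set Om)) (hF : filtration F)
  (W : 'I_d -> R -> Om -> R) (hW : brownian_motion Pr F W)
  (* the solutions [x(t, x0)], [z^0(t, x0)] and [z^j(t, x0)] *)
  (x : X -> R -> Om -> X)
  (hx : forall x0, mild_solution Pr F S W alpha sigma x0 (x x0))
  (z0 : X -> R -> X)
  (hz0 : forall x0,
    mild_ode_solution S (stratonovich_drift alpha sigma) x0 (z0 x0))
  (z : 'I_d -> X -> R -> Om -> X)
  (hz : forall j x0, stratonovich_solution Pr F (W j) (sigma j) x0 (z j x0))
  (* the Markov semigroups on the weighted space over [dom A^l0] *)
  (l0 : nat) (hl0 : (l0 < m)%N)
  (s0 : R) (hs0 : 2 <= s0)
  (P : c0_semigroup (Bpsi (dom_pow S l0) s0))
  (hP : forall t f x0, 0 <= t -> P t f x0 = expect_at Pr x t f x0)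
  (Pj : 'I_d.+1 -> c0_semigroup (Bpsi (dom_pow S l0) s0))
  (hP0 : forall t f x0, 0 <= t ->
    Pj ord0 t f x0 = expect_at Pr (fun y r _ => z0 y r) t f x0)
  (hPj : forall j t f x0, 0 <= t ->
    Pj (lift ord0 j) t f x0 = expect_at Pr (z j) t f x0)
  (bP : exp_bounded P) (bPj : forall j, exp_bounded (Pj j))
  (* the splitting *)
  (T : R) (hT : 0 < T) (p : nat) (hp : (1 <= p)%N)
  (Q : splitting R d.+1)
  (Q_ge0 : nonneg_splitting Q) (Q_order : classical_order p Q)
  (f : Bpsi (dom_pow S l0) s0)
  (hf : smooth_class P Pj T p.+1 f) :
  exists C : R, forall (n : nat) (dt : R), 0 < dt -> n%:R * dt <= T ->
    `|P (n%:R * dt) f - iter n (splitting_op Q Pj dt) f| <= C * dt ^+ p.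
Proof.
exact: splitting_convergence bP bPj Q_ge0 Q_order hf.
Qed.
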